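(* Let $A=(g,F)_n$ be an $n\times n$ pseudo-involution, and let $\sigma_1\ge\sigma_2\ge\cdots\ge\sigma_n$ be the singular values of $A$. Then the singular values of $A$ come in reciprocal pairs $\sigma_i$ and $1/\sigma_i$; that is, $\sigma_{n+1-i}=1/\sigma_i$ for all $i=1,\ldots,n$ (so $\sigma_n=1/\sigma_1$, $\sigma_{n-1}=1/\sigma_2$, and so on).
   Context: $\mathbb{F}$ is the field of real or complex numbers. For formal power series $g,F\in\mathbb{F}[[x]]$ with $g(0)\ne 0$, $F(0)=0$, $F'(0)\neq0$, the Riordan matrix $(g,F)$ is the infinite lower triangular matrix $[a_{ij}]_{i,j\ge 0}$ with $a_{ij}=[x^i]\,g(x)F(x)^j$ (the coefficient of $x^i$), and $(g,F)_n$ is its leading $n\times n$ principal submatrix, called an $n\times n$ Riordan matrix. An $n\times n$ Riordan matrix $A$ is a pseudo-involution if $(AM)^2=I_n$, where $M=\pm(1,-x)_n=\pm\mathrm{diag}(1,-1,1,-1,\ldots)$ of order $n$. *)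

(* Defs.v *)
From HB Require Import structures.
From mathcomp Require Import all_boot all_order all_algebra.
From mathcomp Require Import complex.
From mathcomp Require Import reals.

Set Implicit Arguments.
Unset Strict Implicit.
Unset Printing Implicit Defensive.

Import Order.TTheory GRing.Theory Num.Theory.

Local Open Scope ring_scope.
Local Open Scope sesquilinear_scope.

(* A formal power series is its sequence of coefficients: [x^i] f is f i. *)
Definition fps (K : fieldType) : Type := nat -> K.

Definition fps_one (K : fieldType) : fps K := fun i => (i == 0%N)%:R.

Definition fps_X (K : fieldType) : fps K := fun i => (i == 1%N)%:R.

Definition fps_opp (K : fieldType) (f : fps K) : fps K := fun i => - f i.

Definition fps_mul (K : fieldType) (f h : fps K) : fps K :=
  fun i => \sum_(k < i.+1) f k * h (i - k)%N.

Definition fps_exp (K : fieldType) (f : fps K) (m : nat) : fps K :=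
  iter m (fps_mul f) (fps_one K).

(* F 1 is the value F'(0) of the formal derivative. *)
Definition riordan_pair (K : fieldType) (g F : fps K) : Prop :=
  [/\ g 0%N != 0, F 0%N = 0 & F 1%N != 0].

Definition riordan (K : fieldType) (g F : fps K) (i j : nat) : K :=
  fps_mul g (fps_exp F j) i.

Definition riordan_mx (K : fieldType) (n : nat) (g F : fps K) : 'M[K]_n :=
  \matrix_(i < n, j < n) riordan g F i j.

(* The matrix (1,-x)_n. *)
Definition alt_mx (K : fieldType) (n : nat) : 'M[K]_n :=
  riordan_mx n (fps_one K) (fps_opp (fps_X K)).

Definition pseudo_involution (K : fieldType) (n : nat) (A : 'M[K]_n) : Prop :=
  exists2 M : 'M[K]_n, M = alt_mx K n \/ M = - alt_mx K n &
    (A *m M) *m (A *m M) = 1%:M.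

Definition nonneg_nonincreasing (R : realType) (n : nat) (s : 'I_n -> R) : Prop :=
  (forall i, 0 <= s i) /\ (forall i j : 'I_n, (i <= j)%N -> s j <= s i).

(* The singular values of A are the nonnegative square roots of the eigenvalues
   of A^T A (of A^t* A over R[i]), repeated according to their multiplicities as
   roots of the characteristic polynomial.  The index i : 'I_n starts at 0. *)
Definition real_singular_values (R : realType) (n : nat) (A : 'M[R]_n)
    (s : 'I_n -> R) : Prop :=
  nonneg_nonincreasing s /\
  char_poly (A^T *m A) = \prod_(i < n) ('X - (s i ^+ 2)%:P).

Definition complex_singular_values (R : realType) (n : nat) (A : 'M[R[i]]_n)
    (s : 'I_n -> R) : Prop :=
  nonneg_nonincreasing s /\
  char_poly (A^t* *m A) = \prod_(i < n) ('X - ((s i ^+ 2)%:C)%C%:P).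

Lemma alt_mxE (K : fieldType) (n : nat) :
  alt_mx K n = diag_mx (\row_(j < n) (-1) ^+ j).
Proof.
have E m k : fps_exp (fps_opp (fps_X K)) m k = (k == m)%:R * (-1) ^+ m.
  elim: m k => [|m IH] k; first by rewrite mulr1.
  rewrite /fps_exp iterS -/(fps_exp _ m) /fps_mul.
  case: k => [|k].
    by rewrite big_ord1 /fps_opp /fps_X /= oppr0 !mul0r.
  rewrite (bigD1 (@Ordinal k.+2 1 isT)) //= big1 ?addr0.
    by rewrite IH subSS subn0 eqSS /fps_opp /fps_X exprS mulN1r mulrN mulN1r.
  move=> [i hi] /= hne; rewrite /fps_opp /fps_X.
  by have /negbTE -> : i != 1%N by []; rewrite oppr0 mul0r.
apply/matrixP => i j; rewrite !mxE /riordan /fps_mul big_ord_recl big1 /=.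
  by rewrite addr0 E subn0 mul1r mulr_natl eq_sym val_eqE eq_sym; case: eqP => // ->.
by move=> k _; rewrite mul0r.
Qed.

Lemma nonneg_nonincreasing_sqrt (R : realType) (n : nat) (d : 'I_n -> R) :
  (forall i, 0 <= d i) ->
  exists2 s : 'I_n -> R, nonneg_nonincreasing s &
    forall (T : comNzRingType) (f : R -> T),
      \prod_(i < n) f (d i) = \prod_(i < n) f (s i ^+ 2).
Proof.
move=> d0; pose l := sort >=%R [seq Num.sqrt (d i) | i : 'I_n].
have sl : size l = n by rewrite size_sort size_map size_enum_ord.
have l0 x : x \in l -> 0 <= x.
  by rewrite mem_sort => /mapP[i _ ->]; rewrite sqrtr_ge0.
exists (fun i => nth 0 l i) => [|T f].
  split=> [i|i j ij]; first by apply/l0/mem_nth; rewrite sl.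
  apply: (sorted_leq_nth (leT := >=%R)) => //.
  - by move=> x y z /= xy yz; apply: le_trans yz xy.
  - by move=> x /=.
  - by apply: sort_sorted => x y; apply: ge_total.
  - by rewrite inE sl.
  - by rewrite inE sl.
rewrite -(big_mkord xpredT (fun i => f (nth 0 l i ^+ 2))).
rewrite -[X in _ = \big[_/_]_(0 <= i < X | _) _]sl.
rewrite -(big_nth 0 xpredT (fun x => f (x ^+ 2))).
rewrite (perm_big _ (permEl (perm_sort _ _))) big_map big_enum /=.
by apply: eq_bigr => i _; rewrite sqr_sqrtr.
Qed.

Lemma complex_singular_values_exist (R : realType) (n : nat) (A : 'M[R[i]]_n) :
  exists s, complex_singular_values A s.
Proof.
pose B := A^t* *m A; pose P := spectralmx B; pose d := spectral_diag B.
have tK m (M : 'M[R[i]]_(n, m)) : (M^t*)^t* = M.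
  by apply/matrixP => i j; rewrite !mxE conjCK.
have Bh : B^t* = B by rewrite /B trmx_mul map_mxM /= tK.
have Bn : B \is normalmx by apply/normalmxP; rewrite Bh.
have eB : B = invmx P *m diag_mx d *m P by apply/orthomx_spectralP.
have Pu : P \is unitarymx := spectral_unitarymx B.
have Pi : P \in unitmx := unitarymx_unit Pu.
have eD : diag_mx d = (A *m P^t*)^t* *m (A *m P^t*).
  have -> : (A *m P^t*)^t* = P *m A^t*.
    by rewrite trmx_mul map_mxM /= tK.
  rewrite -mulmxA (mulmxA (A^t*)) -/B eB -(invmx_unitary Pu).
  by rewrite !mulmxA mulmxV // mul1mx mulmxK.
have d0 i : 0 <= d 0 i.
  have -> : d 0 i = (diag_mx d) i i by rewrite mxE eqxx.
  rewrite eD mxE sumr_ge0 // => k _; rewrite !mxE mulrC; exact: mul_conjC_ge0.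
have [|s s0 sE] := @nonneg_nonincreasing_sqrt R n (fun i => complex.Re (d 0 i)).
  by move=> i; have := d0 i; rewrite lecE => /andP[].
exists s; split=> //; rewrite -/B.
rewrite -(sE _ (fun x => 'X - (x%:C)%C%:P)).
have -> : char_poly B = char_poly (diag_mx d).
  have -> : diag_mx d = P *m B *m invmx P.
    by rewrite eB !mulmxA mulmxV // mul1mx mulmxK.
  rewrite /char_poly /char_poly_mx.
  have PP : map_mx polyC P *m map_mx polyC (invmx P) = 1%:M.
    by rewrite -map_mxM mulmxV // map_mx1.
  have -> : 'X%:M - map_mx polyC (P *m B *m invmx P) =
      map_mx polyC P *m ('X%:M - map_mx polyC B) *m map_mx polyC (invmx P).
    rewrite mulmxBr mulmxBl !map_mxM /=; congr (_ - _).
    by rewrite scalar_mxC -mulmxA PP mulmx1.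
  by rewrite !det_mulmx mulrAC -det_mulmx PP det1 mul1r.
rewrite char_poly_trig ?diag_mx_is_trig //; apply: eq_bigr => i _.
congr ('X - _%:P); rewrite mxE eqxx mulr1n.
by have := ger0_Im (d0 i); case: (d 0 i) => a b /= ->.
Qed.

Lemma real_singular_values_exist (R : realType) (n : nat) (A : 'M[R]_n) :
  exists s, real_singular_values A s.
Proof.
have [s [s0 sE]] := complex_singular_values_exist (map_mx (real_complex R) A).
exists s; split=> //; apply: (map_poly_inj (real_complex R)).
rewrite map_char_poly map_mxM rmorph_prod /=.
have -> : (map_mx (real_complex R) A^T) = (map_mx (real_complex R) A)^t*.
  by apply/matrixP => i j; rewrite !mxE; apply/esym/conjc_real.
by rewrite sE; apply: eq_bigr => i _; rewrite rmorphB /= map_polyX map_polyC.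
Qed.

(* Main.v *)
Require Import Defs.
From mathcomp Require Import all_boot all_order all_algebra.
From mathcomp Require Import complex.
From mathcomp Require Import reals.

Set Implicit Arguments.
Unset Strict Implicit.
Unset Printing Implicit Defensive.

Import Order.TTheory GRing.Theory Num.Theory.

Local Open Scope ring_scope.

Local Open Scope sesquilinear_scope.

(** If [A M] squares to the identity, with [M] a self-adjoint involution, then
    [A^-1 = M A M], hence [(A^* A)^-1 = M A A^* M = (M A) (A^* A) (M A)^-1]:
    the positive definite matrix [A^* A] is similar to its own inverse
    ([char_poly_gram_involution]).  The eigenvalues of an inverse matrix are
    the inverses of the eigenvalues, with the same multiplicities
    ([char_poly_left_inverse]), so the multiset of the squared singular values
    is stable under [x |-> x^-1].  Inversion reverses the order of positive
    numbers, so the nonincreasing list of the squares coincides with the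
    reversed list of their inverses ([rev_inv_nonincreasing]); taking square
    roots gives the reciprocal pairs.

    Here [M = (1,-x)_n] or [M = - (1,-x)_n] qualifies because [(1,-x)_n] is a
    diagonal matrix of signs.  A real matrix keeps its singular values when it
    is seen as a complex one, so the complex case covers both. *)

Lemma horner_char_poly (K : comNzRingType) (n : nat) (A : 'M[K]_n) (x : K) :
  (char_poly A).[x] = \det (x%:M - A).
Proof.
rewrite -[LHS]/(horner_eval x _) -det_map_mx; congr (\det _).
apply/matrixP => i j; rewrite !mxE /= /horner_eval hornerD hornerN hornerC.
by rewrite hornerMn hornerX.
Qed.

Lemma char_poly_similar (K : comUnitRingType) (n : nat) (P B C : 'M[K]_n) :
  P \in unitmx -> C *m P = P *m B -> char_poly C = char_poly B.
Proof.
move=> Pu CP.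
have PP : map_mx polyC P *m map_mx polyC (invmx P) = 1%:M.
  by rewrite -map_mxM mulmxV // map_mx1.
have -> : C = P *m B *m invmx P by rewrite -CP mulmxK.
rewrite /char_poly /char_poly_mx.
have -> : 'X%:M - map_mx polyC (P *m B *m invmx P) =
    map_mx polyC P *m ('X%:M - map_mx polyC B) *m map_mx polyC (invmx P).
  rewrite mulmxBr mulmxBl !map_mxM /=; congr (_ - _).
  by rewrite scalar_mxC -mulmxA PP mulmx1.
by rewrite !det_mulmx mulrAC -det_mulmx PP det1 mul1r.
Qed.

Lemma poly_eq_nonzero (K : numFieldType) (p q : {poly K}) :
  (forall x, x != 0 -> p.[x] = q.[x]) -> p = q.
Proof.
move=> pq; apply/eqP; rewrite -subr_eq0; apply/eqP.
apply: (@roots_geq_poly_eq0 _ _ [seq i.+1%:R | i <- iota 0 (size (p - q))]).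
- apply/allP => _ /mapP[i _ ->]; rewrite rootE hornerD hornerN pq ?subrr //.
  by rewrite pnatr_eq0.
- rewrite map_inj_uniq ?iota_uniq // => i j /eqP.
  by rewrite eqr_nat eqSS => /eqP.
- by rewrite size_map size_iota.
Qed.

Lemma char_poly_roots_neq0 (K : fieldType) (n : nat) (B : 'M[K]_n)
    (d : 'I_n -> K) :
  B \in unitmx -> char_poly B = \prod_(i < n) ('X - (d i)%:P) ->
  forall i, d i != 0.
Proof.
rewrite unitmxE unitfE => detB Bd i; apply: contraNneq detB => di0.
have := horner_char_poly B 0; rewrite Bd horner_prod (bigD1 i) //=.
rewrite !hornerE di0 oppr0 mul0r raddf0 sub0r -scaleN1r detZ => /esym/eqP.
by rewrite mulf_eq0 expf_eq0 oppr_eq0 oner_eq0 andbF.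
Qed.

Lemma char_poly_left_inverse (K : numFieldType) (n : nat) (B C : 'M[K]_n)
    (d : 'I_n -> K) :
  C *m B = 1%:M -> char_poly B = \prod_(i < n) ('X - (d i)%:P) ->
  char_poly C = \prod_(i < n) ('X - (d i)^-1%:P).
Proof.
move=> CB Bd.
have Bu : B \in unitmx by case/mulmx1_unit: CB.
have d0 := char_poly_roots_neq0 Bu Bd.
have detB : \det B = \prod_(i < n) d i.
  have := horner_char_poly B 0; rewrite Bd horner_prod raddf0 sub0r.
  rewrite -scaleN1r detZ (eq_bigr (fun i => -1 * d i)) => [|i _].
    rewrite big_split /= prodr_const card_ord => /(mulfI _) -> //.
    by rewrite expf_eq0 oppr_eq0 oner_eq0 andbF.
  by rewrite !hornerE mulN1r.
apply: poly_eq_nonzero => x x0.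
have detB0 : \det B != 0 by rewrite -unitfE -unitmxE.
apply: (mulIf detB0).
(* (x - C) B = x B - 1 = - x (x^-1 - B), so the left-hand side is a multiple
   of char_poly B at x^-1. *)
rewrite horner_char_poly -det_mulmx mulmxBl CB.
have -> : x%:M *m B - 1%:M = - x *: (x^-1%:M - B).
  rewrite scalerBr scale_scalar_mx mulNr mulfV // scaleNr opprK mul_scalar_mx.
  by rewrite addrC raddfN.
rewrite detZ -horner_char_poly Bd !horner_prod detB -[X in _ ^+ X]card_ord.
rewrite -prodr_const -!big_split /=; apply: eq_bigr => i _; rewrite !hornerE.
by rewrite mulrBr mulrBl mulNr mulfV // mulVf // mulNr opprK addrC.
Qed.

Lemma sorted_ge_map_enum (R : numDomainType) (n : nat) (f : 'I_n -> R) :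
  (forall i j : 'I_n, (i <= j)%N -> f j <= f i) ->
  sorted >=%R [seq f i | i <- enum 'I_n].
Proof.
move=> fdec; rewrite sorted_map.
apply: (@sub_sorted _ (relpre val leq)) => [i j /= ij|]; first exact: fdec.
by rewrite -sorted_map val_enum_ord iota_sorted.
Qed.

(** The polynomial equation says that the multiset of the [d i] is stable under
    inversion; then [d] and [i |-> (d (rev_ord i))^-1] are two nonincreasing
    enumerations of the same multiset, hence equal. *)
Lemma rev_inv_nonincreasing (R : numFieldType) (n : nat) (d : 'I_n -> R) :
  (forall i, 0 < d i) -> (forall i j : 'I_n, (i <= j)%N -> d j <= d i) ->
  \prod_(i < n) ('X - (d i)%:P) = \prod_(i < n) ('X - (d i)^-1%:P) ->
  forall i, d (rev_ord i) = (d i)^-1.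
Proof.
move=> d0 ddec dV i.
pose e i := (d (rev_ord i))^-1.
have edec (j k : 'I_n) : (j <= k)%N -> e k <= e j.
  move=> jk; rewrite /e lef_pV2 ?posrE ?d0 //; apply: ddec => /=.
  by rewrite leq_sub2l.
have de : [seq d j | j <- enum 'I_n] = [seq e j | j <- enum 'I_n].
  apply: (@sorted_eq _ >=%R).
  - by move=> x y z /= xy yz; apply: le_trans yz xy.
  - by move=> x y /andP[/= yx xy]; apply/le_anti/andP.
  - exact: sorted_ge_map_enum.
  - exact: sorted_ge_map_enum.
  - apply: prod_XsubC_eq; rewrite (big_map d) (big_map e).
    by rewrite !big_enum /= dV (reindex_inj rev_ord_inj).
have /eq_in_map/(_ i (mem_enum _ _)) -> := de.
by rewrite /e invrK.
Qed.

(** The inverse of the Gram matrix [A^* A] is [C = M A A^* M], and [M A]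
    conjugates one into the other. *)
Lemma char_poly_gram_involution (R : realType) (n : nat) (A M : 'M[R[i]]_n) :
  M *m M = 1%:M -> M^t* = M -> (A *m M) *m (A *m M) = 1%:M ->
  exists2 C, C *m (A^t* *m A) = 1%:M & char_poly C = char_poly (A^t* *m A).
Proof.
move=> MM Mh AM2.
have AMh : M *m A^t* *m (M *m A^t*) = 1%:M.
  have := congr1 (fun X => X^t*) AM2.
  by rewrite /= !trmx_mul !map_mxM /= Mh trmx1 map_mx1.
have AhMAh : A^t* *m M *m A^t* = M.
  by rewrite -[LHS]mul1mx -{1}MM -[in RHS](mulmx1 M) -AMh !mulmxA.
have MAMA : M *m A *m M *m A = 1%:M.
  by rewrite -mulmxA in AM2; have := mulmx1C AM2; rewrite !mulmxA.
have MAu : M *m A \in unitmx.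
  by move: MAMA; rewrite -mulmxA => /mulmx1_unit[].
exists (M *m A *m A^t* *m M).
  by rewrite -[RHS]MAMA -[in X in _ = _ *m X *m _]AhMAh !mulmxA.
by apply: (char_poly_similar MAu); rewrite -!mulmxA (mulmxA M M) MM mul1mx.
Qed.

Lemma alt_mx_sqr (K : fieldType) (n : nat) : alt_mx K n *m alt_mx K n = 1%:M.
Proof.
rewrite alt_mxE mulmx_diag -diag_const_mx; congr diag_mx.
by apply/rowP => j; rewrite !mxE -expr2 sqrr_sign.
Qed.

Lemma alt_mx_adjoint (R : realType) (n : nat) :
  (alt_mx R[i] n)^t* = alt_mx R[i] n.
Proof.
rewrite alt_mxE tr_diag_mx map_diag_mx; congr diag_mx.
by apply/rowP => j; rewrite !mxE rmorph_sign.
Qed.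

Lemma alt_mx_map (K L : fieldType) (f : {rmorphism K -> L}) (n : nat) :
  map_mx f (alt_mx K n) = alt_mx L n.
Proof.
rewrite !alt_mxE map_diag_mx; congr diag_mx.
by apply/rowP => j; rewrite !mxE rmorph_sign.
Qed.

Lemma pseudo_involution_map (K L : fieldType) (f : {rmorphism K -> L})
    (n : nat) (A : 'M[K]_n) :
  pseudo_involution A -> pseudo_involution (map_mx f A).
Proof.
case=> M HM AM; exists (map_mx f M); last by rewrite -!map_mxM AM map_mx1.
by case: HM => ->; [left | right]; rewrite ?map_mxN alt_mx_map.
Qed.

Lemma real_singular_values_complex (R : realType) (n : nat) (A : 'M[R]_n)
    (s : 'I_n -> R) :
  real_singular_values A s ->
  complex_singular_values (map_mx (real_complex R) A) s.
Proof.
case=> s0 As; split=> //.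
have -> : (map_mx (real_complex R) A)^t* = map_mx (real_complex R) A^T.
  by apply/matrixP => i j; rewrite !mxE; apply: conjc_real.
rewrite -map_mxM -map_char_poly As rmorph_prod; apply: eq_bigr => i _ /=.
by rewrite rmorphB /= map_polyX map_polyC.
Qed.

Lemma pseudo_involution_singular_values (R : realType) (n : nat)
    (A : 'M[R[i]]_n) (s : 'I_n -> R) :
  pseudo_involution A -> complex_singular_values A s ->
  forall i, 0 < s i /\ s (rev_ord i) = 1 / s i.
Proof.
move=> [M HM AM] [[s0 sdec] As].
have MM : M *m M = 1%:M.
  by case: HM => ->; rewrite ?mulNmx ?mulmxN ?opprK alt_mx_sqr.
have Mh : M^t* = M.
  by case: HM => ->; rewrite ?raddfN /= ?map_mxN alt_mx_adjoint.
have [C CB CBp] := char_poly_gram_involution MM Mh AM.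
have Bu : A^t* *m A \in unitmx by case/mulmx1_unit: CB.
have sn0 i : s i != 0.
  have := char_poly_roots_neq0 Bu As i; apply: contraNneq => ->.
  by rewrite expr0n rmorph0.
have s_gt0 i : 0 < s i by rewrite lt_neqAle eq_sym sn0 s0.
have sV : \prod_(i < n) ('X - (s i ^+ 2)%:P) =
    \prod_(i < n) ('X - (s i ^+ 2)^-1%:P).
  apply: (map_poly_inj (real_complex R)); rewrite !rmorph_prod /=.
  have := char_poly_left_inverse CB As; rewrite CBp As => E.
  rewrite (eq_bigr (fun i => 'X - ((s i ^+ 2)%:C)%C%:P)) => [|i _]; last first.
    by rewrite rmorphB /= map_polyX map_polyC.
  rewrite E; apply: eq_bigr => i _.
  rewrite rmorphB /= map_polyX map_polyC; congr (_ - _%:P).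
  exact/esym/(fmorphV (real_complex R)).
move=> i; split=> //; rewrite div1r.
apply: (pexpIrn (n := 2)) => //; rewrite ?nnegrE ?invr_ge0 //.
rewrite exprVn; apply: (rev_inv_nonincreasing (d := fun i => s i ^+ 2)) => //.
  by move=> j; rewrite exprn_gt0.
by move=> j k jk; rewrite lerXn2r ?nnegrE //; apply: sdec.
Qed.

Theorem theorem2p3 (R : realType) :
  (forall (n : nat) (g F : fps R) (sigma : 'I_n -> R),
     riordan_pair g F ->
     pseudo_involution (riordan_mx n g F) ->
     real_singular_values (riordan_mx n g F) sigma ->
     forall i : 'I_n, 0 < sigma i /\ sigma (rev_ord i) = 1 / sigma i)
  /\
  (forall (n : nat) (g F : fps R[i]) (sigma : 'I_n -> R),
     riordan_pair g F ->
     pseudo_involution (riordan_mx n g F) ->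
     complex_singular_values (riordan_mx n g F) sigma ->
     forall i : 'I_n, 0 < sigma i /\ sigma (rev_ord i) = 1 / sigma i).
Proof.
split=> n g F sigma _ pA sA; last exact: pseudo_involution_singular_values sA.
apply: pseudo_involution_singular_values (real_singular_values_complex sA).
exact: pseudo_involution_map.
Qed.
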